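(* Let $K_{jklm}$ be a generalized curvature tensor on a Riemannian or pseudo-Riemannian manifold $(M,g)$ of dimension $n$. If $a_{ij}$ and $b_{ij}$ are $K$-compatible symmetric tensors, then the symmetric tensor $\tfrac12(ab+ba)$, with components $\tfrac12\left(a_i{}^k b_{kj}+b_i{}^k a_{kj}\right)$, is $K$-compatible.
   Context: $(M,g)$ is an $n$-dimensional Riemannian or pseudo-Riemannian manifold. Indices are raised and lowered with $g$, and repeated indices are summed. A generalized curvature tensor (GCT) is a tensor $K_{jklm}$ with the algebraic symmetries of the Riemann tensor: $K_{jklm}=-K_{kjlm}=-K_{jkml}$, $K_{jklm}+K_{kljm}+K_{ljkm}=0$, and $K_{jklm}=K_{lmjk}$. A symmetric tensor $b_{ij}=b_{ji}$ is called $K$-compatible if $b_i{}^m K_{jklm}+b_j{}^m K_{kilm}+b_k{}^m K_{ijlm}=0$ for all $i,j,k,l$. *)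

(* Defs.v *)
From HB Require Import structures.
From mathcomp Require Import all_boot all_order all_algebra.
From mathcomp Require Import all_classical all_reals all_analysis.
Set Implicit Arguments.
Unset Strict Implicit.
Unset Printing Implicit Defensive.
Import Order.TTheory GRing.Theory Num.Theory numFieldNormedType.Exports.
Local Open Scope classical_set_scope.
Local Open Scope ring_scope.

(** * Smooth functions on open subsets of R^n *)

Section Smooth.
Context {R : realType} {n : nat}.

Definition pderive (i : 'I_n) (f : 'rV[R]_n -> R) (x : 'rV[R]_n) : R :=
  'D_(delta_mx 0 i) f x.

(* Meant for open U: f is a total function, but then continuity and the
   iterated partial derivatives at points of U only see its values on U. *)
Fixpoint Ck_on (k : nat) (U : set 'rV[R]_n) (f : 'rV[R]_n -> R) : Prop :=
  (forall x, U x -> {for x, continuous f}) /\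
  if k is k'.+1 then
    forall i : 'I_n,
      (forall x, U x -> derivable f x (delta_mx 0 i)) /\
      Ck_on k' U (pderive i f)
  else True.

Definition smooth_on (U : set 'rV[R]_n) (f : 'rV[R]_n -> R) : Prop :=
  forall k, Ck_on k U f.

End Smooth.

(** * Smooth manifolds *)

(* A chart is a homeomorphism from an open set onto an open subset of R^n.
   The two maps are total; their values outside of [chart_dom] and
   [chart_cod], respectively, are irrelevant. *)
Record chart (R : realType) (n : nat) (M : topologicalType) := Chart {
  chart_dom : set M;
  chart_map : M -> 'rV[R]_n;
  chart_inv : 'rV[R]_n -> M;
  open_chart_dom : open chart_dom;
  open_chart_cod : open (chart_map @` chart_dom);
  chart_mapK : forall p, chart_dom p -> chart_inv (chart_map p) = p;
  chart_map_continuous : forall p, chart_dom p -> {for p, continuous chart_map};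
  chart_inv_continuous : forall x, (chart_map @` chart_dom) x ->
    {for x, continuous chart_inv}
}.

Section Charts.
Context {R : realType} {n : nat} {M : topologicalType}.
Implicit Types c d : chart R n M.

Definition chart_cod c : set 'rV[R]_n := chart_map c @` chart_dom c.

Definition transition c d (x : 'rV[R]_n) : 'rV[R]_n :=
  chart_map d (chart_inv c x).

Definition smooth_transition c d : Prop :=
  forall j : 'I_n,
    smooth_on (chart_map c @` (chart_dom c `&` chart_dom d))
              (fun x => transition c d x 0 j).

(* The entry (i, j) is d y^j / d x^i at p, with x the coordinates of c and
   y those of d. *)
Definition jacobian_at c d (p : M) : 'M[R]_n :=
  \matrix_(i < n, j < n)
    pderive i (fun x => transition c d x 0 j) (chart_map c p).

End Charts.

(* The atlas is not required to be maximal: tensor fields and their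
   smoothness are determined by any atlas of the smooth structure. *)
Record manifold (R : realType) (n : nat) := Manifold {
  points :> topologicalType;
  atlas : set (chart R n points);
  manifold_hausdorff : hausdorff_space points;
  manifold_second_countable : @second_countable points;
  atlas_cover : forall p : points, exists2 c, atlas c & chart_dom c p;
  atlas_smooth : forall c d, atlas c -> atlas d -> smooth_transition c d
}.

(** * Tensor fields, given by their components in the charts of the atlas *)

Section Tensors.
Context {R : realType} {n : nat} (M : manifold R n).

(* [T c p] are the components at p in the chart c; they are only meaningful
   for c in the atlas and p in the domain of c. *)
Definition components2 := chart R n M -> M -> 'M[R]_n.
Definition components4 :=
  chart R n M -> M -> 'I_n -> 'I_n -> 'I_n -> 'I_n -> R.

(* Smooth covariant tensor fields of rank 2 and 4. *)
Definition tensor2 (b : components2) : Prop :=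
  (forall c d p, atlas c -> atlas d -> chart_dom c p -> chart_dom d p ->
     let J := jacobian_at c d p in
     forall i j, b c p i j = \sum_k \sum_l J i k * J j l * b d p k l) /\
  (forall c, atlas c -> forall i j,
     smooth_on (chart_cod c) (fun x => b c (chart_inv c x) i j)).

Definition tensor4 (K : components4) : Prop :=
  (forall c d p, atlas c -> atlas d -> chart_dom c p -> chart_dom d p ->
     let J := jacobian_at c d p in
     forall i j k l, K c p i j k l =
       \sum_q \sum_r \sum_s \sum_t
         J i q * J j r * J k s * J l t * K d p q r s t) /\
  (forall c, atlas c -> forall i j k l,
     smooth_on (chart_cod c) (fun x => K c (chart_inv c x) i j k l)).

Definition symmetric_tensor (b : components2) : Prop :=
  tensor2 b /\
  forall c p, atlas c -> chart_dom c p -> forall i j, b c p i j = b c p j i.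

(* No signature is prescribed: Riemannian and pseudo-Riemannian metrics are
   the symmetric tensor fields that are nondegenerate at every point. *)
Definition metric (g : components2) : Prop :=
  symmetric_tensor g /\
  forall c p, atlas c -> chart_dom c p -> g c p \in unitmx.

Definition generalized_curvature_tensor (K : components4) : Prop :=
  tensor4 K /\
  forall c p, atlas c -> chart_dom c p -> forall j k l m,
    [/\ K c p j k l m = - K c p k j l m,
        K c p j k l m = - K c p j k m l,
        K c p j k l m + K c p k l j m + K c p l j k m = 0
      & K c p j k l m = K c p l m j k].

(* [raise g b c p i m] is b_i^m = b_{is} g^{sm}. *)
Definition raise (g b : components2) : components2 :=
  fun c p => \matrix_(i < n, m < n) \sum_s b c p i s * invmx (g c p) s m.

Definition K_compatible (g : components2) (K : components4)
    (b : components2) : Prop :=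
  forall c p, atlas c -> chart_dom c p -> forall i j k l,
    \sum_m (raise g b c p i m * K c p j k l m
          + raise g b c p j m * K c p k i l m
          + raise g b c p k m * K c p i j l m) = 0.

Definition jordan_product (g a b : components2) : components2 :=
  fun c p => \matrix_(i < n, j < n)
    (2^-1 * \sum_k (raise g a c p i k * b c p k j
                  + raise g b c p i k * a c p k j)).

End Tensors.

(* Main.v *)
(** Let [A = a g^-1] and [B = b g^-1]. Pointwise, regard [K] as a quadrilinear
form. Compatibility of [A], with one argument replaced by its image under [B],
expresses [K(y, z, w, A B x)] through terms [K(w, A u, t, B v)]. In the cyclic
sum of these for [A B] and [B A], the Bianchi identity of [K] turns everything
into [W(t, u, v, s) = K(A t, B u, v, s) + K(B t, A u, v, s)], and the sum is a
Bianchi sum of [W]; it vanishes because [W] is again a curvature tensor, its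
Bianchi identity being the compatibility of [A] and [B].

That the product is a tensor uses that the transformation law of [g] makes the
Jacobians invertible; smoothness of [g^-1] follows from Cramer's rule. *)
Require Import Defs.
From mathcomp Require Import all_boot all_order all_algebra.
From mathcomp Require Import all_classical all_reals all_analysis.
From mathcomp Require Import ring lra.
Set Implicit Arguments.
Unset Strict Implicit.
Unset Printing Implicit Defensive.
Import GRing.Theory Num.Theory numFieldNormedType.Exports.
Local Open Scope classical_set_scope.
Local Open Scope ring_scope.

(** * The pointwise identity for curvature-like forms *)

(** Every step is a linear combination of instances of the hypotheses, found by [lra]; hence [V] is
    a bare type, and [A] and [B] are plain maps. *)
Lemma jordan_cyclic_identity (R : realFieldType) (V : Type)
    (F : V -> V -> V -> V -> R) (A B : V -> V) :
  (forall x y z w, F x y z w = - F y x z w) ->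
  (forall x y z w, F x y z w = F z w x y) ->
  (forall x y z w, F x y z w + F y z x w + F z x y w = 0) ->
  (forall x y z w, F y z w (A x) + F z x w (A y) + F x y w (A z) = 0) ->
  (forall x y z w, F y z w (B x) + F z x w (B y) + F x y w (B z) = 0) ->
  forall x y z w,
    F y z w (A (B x)) + F y z w (B (A x))
    + (F z x w (A (B y)) + F z x w (B (A y)))
    + (F x y w (A (B z)) + F x y w (B (A z))) = 0.
Proof.
move=> F12 Fp Fb FA FB x y z w.
have F34 t u v s : F t u v s = - F t u s v by rewrite Fp F12 Fp.
have SA t u v s : F t u s (A (B v)) = F s (A u) t (B v) - F s (A t) u (B v).
  rewrite (Fp s (A u)) (Fp s (A t)).
  by have := FA (B v) t u s; have := F12 (B v) t s (A u); lra.
have SB t u v s : F t u s (B (A v)) = F s (B u) t (A v) - F s (B t) u (A v).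
  rewrite (Fp s (B u)) (Fp s (B t)).
  by have := FB (A v) t u s; have := F12 (A v) t s (B u); lra.
pose W t u v s := F (A t) (B u) v s + F (B t) (A u) v s.
have W12 t u v s : W t u v s = - W u t v s.
  by rewrite /W (F12 (A t)) (F12 (B t)); lra.
have W34 t u v s : W t u v s = - W t u s v.
  by rewrite /W (F34 (A t)) (F34 (B t)); lra.
have Wb t u v s : W t u v s + W t v s u + W t s u v = 0.
  rewrite /W.
  have := FA u v s (B t); have := FB u v s (A t).
  rewrite !(Fp _ _ (A t)) !(Fp _ _ (B t)); lra.
(* As for the Riemann tensor, pair symmetry follows from the two antisymmetries and four cyclic
   identities. *)
have Wp t u v s : W t u v s = W v s t u.
  have := Wb t u v s; have := Wb u v s t; have := Wb v s t u.
  have := Wb s t u v.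
  have := W34 t v s u; have := W34 u v s t; have := W34 u s v t.
  have := W12 u t v s; have := W12 v t u s; have := W12 v u s t.
  by have := W12 s t u v; have := W12 s u v t; have := W12 s v t u; lra.
(* Bianchi in [w], [A t], [u] with [B v] kept last. It merges a term of [SA] and a term of [SB] into
   one summand of [W t v w u]. *)
have K t u v : F w (A t) u (B v) - F w (B v) u (A t) = F (A t) (B v) w u.
  rewrite (Fp w (B v)) (Fp (A t)); have := Fb w (A t) u (B v).
  by have := F12 u (A t) w (B v); have := F12 u w (A t) (B v); lra.
(* [Wb] keeps the first slot fixed; [Wp] moves the fixed [w] to the third slot. *)
have Wc : W x z w y + W z y w x + W y x w z = 0.
  have := Wb w y x z; have := Wp x z w y; have := Wp z y w x.
  have := Wp y x w z; have := W34 w y x z; have := W34 w x z y.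
  by have := W34 w z y x; lra.
(* Of the twelve terms that appear, the six instances of [K] pair each one from [SA] with one from
   [SB]; the result is the negative of the sum in [Wc]. *)
rewrite !SA !SB; move: Wc; rewrite /W.
rewrite (F12 (B x)) (F12 (B y)) (F12 (B z)).
have := K x y z; have := K z y x; have := K x z y; have := K y z x.
by have := K y x z; have := K z x y; lra.
Qed.

(** * From identities in indices to identities on row vectors *)

Section MultilinearExtension.
Context {R : comNzRingType} {n : nat}.
Implicit Types (T : 'I_n -> 'I_n -> 'I_n -> 'I_n -> R) (u v w z : 'rV[R]_n).

(** On vectors, contracting the last index with a matrix is the substitution of [z *m A] for [z],
    the form that [jordan_cyclic_identity] handles. *)
Definition mlin4 T u v w z : R :=
  \sum_i \sum_j \sum_k \sum_l u 0 i * v 0 j * w 0 k * z 0 l * T i j k l.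

Lemma eq_mlin4 T T' u v w z :
  (forall i j k l, T i j k l = T' i j k l) ->
  mlin4 T u v w z = mlin4 T' u v w z.
Proof. by move=> TT'; do 4!(apply: eq_bigr => ? _); rewrite TT'. Qed.

Lemma mlin4_eq0 T u v w z :
  (forall i j k l, T i j k l = 0) -> mlin4 T u v w z = 0.
Proof. by move=> T0; do 4!(apply: big1 => ? _); rewrite T0 mulr0. Qed.

Lemma mlin4D T T' u v w z :
  mlin4 T u v w z + mlin4 T' u v w z =
  mlin4 (fun i j k l => T i j k l + T' i j k l) u v w z.
Proof.
by do 4!(rewrite -big_split; apply: eq_bigr => ? _ /=); rewrite mulrDr.
Qed.

Lemma mlin4N T u v w z :
  - mlin4 T u v w z = mlin4 (fun i j k l => - T i j k l) u v w z.
Proof. by do 4!(rewrite -sumrN; apply: eq_bigr => ? _ /=); rewrite mulrN. Qed.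

(** Adjacent transpositions generate all permutations of the arguments; with them, terms are brought
    to one common order and compared coefficientwise. *)
Lemma mlin4_swap12 T u v w z :
  mlin4 T u v w z = mlin4 (fun i j => T j i) v u w z.
Proof.
rewrite /mlin4 exchange_big /=.
by do 4!(apply: eq_bigr => ? _); congr (_ * _ * _ * _); rewrite mulrC.
Qed.

Lemma mlin4_swap23 T u v w z :
  mlin4 T u v w z = mlin4 (fun i j k => T i k j) u w v z.
Proof.
apply: eq_bigr => i _; rewrite exchange_big /=.
by do 3!(apply: eq_bigr => ? _); congr (_ * _ * _); rewrite mulrAC.
Qed.

Lemma mlin4_swap34 T u v w z :
  mlin4 T u v w z = mlin4 (fun i j k l => T i j l k) u v z w.
Proof.
do 2!(apply: eq_bigr => ? _); rewrite exchange_big /=.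
by do 2!(apply: eq_bigr => ? _); congr (_ * _); rewrite mulrAC.
Qed.

Lemma mlin4_mulmx T u v w z (A : 'M[R]_n) :
  mlin4 T u v w (z *m A) =
  mlin4 (fun i j k l => \sum_m A l m * T i j k m) u v w z.
Proof.
do 3!(apply: eq_bigr => ? _).
under eq_bigr do rewrite mxE mulr_sumr mulr_suml.
rewrite exchange_big /=; apply: eq_bigr => l _; rewrite mulr_sumr.
by apply: eq_bigr => m _; rewrite !mulrA.
Qed.

Lemma mlin4_delta T i j k l :
  mlin4 T (delta_mx 0 i) (delta_mx 0 j) (delta_mx 0 k) (delta_mx 0 l) =
  T i j k l.
Proof.
have sum_delta (f : 'I_n -> R) h c :
    \sum_(m < n) c * (delta_mx 0 h : 'rV[R]_n) 0 m * f m = c * f h.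
  rewrite (bigD1 h) //= big1 => [|m /negPf mh]; rewrite !mxE.
    by rewrite !eqxx mulr1 addr0.
  by rewrite mh mulr0 mul0r.
rewrite /mlin4.
under eq_bigr do under eq_bigr do under eq_bigr do rewrite sum_delta.
under eq_bigr do under eq_bigr do rewrite sum_delta.
under eq_bigr do rewrite sum_delta.
(* [sum_delta] expects a left factor, which the outermost sum lacks. *)
under eq_bigr do rewrite -[X in X * T _ _ _ _]mul1r.
by rewrite sum_delta mul1r.
Qed.

End MultilinearExtension.

Lemma compatible_jordan_mx (R : realFieldType) (n : nat)
    (T : 'I_n -> 'I_n -> 'I_n -> 'I_n -> R) (A B : 'M[R]_n) :
  (forall j k l m, [/\ T j k l m = - T k j l m, T j k l m = - T j k m l,
     T j k l m + T k l j m + T l j k m = 0 & T j k l m = T l m j k]) ->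
  (forall i j k l, \sum_m (A i m * T j k l m + A j m * T k i l m
                           + A k m * T i j l m) = 0) ->
  (forall i j k l, \sum_m (B i m * T j k l m + B j m * T k i l m
                           + B k m * T i j l m) = 0) ->
  forall i j k l,
    \sum_m ((A *m B + B *m A) i m * T j k l m
            + (A *m B + B *m A) j m * T k i l m
            + (A *m B + B *m A) k m * T i j l m) = 0.
Proof.
move=> symT compA compB.
have compE (C : 'M[R]_n) :
    (forall i j k l, \sum_m (C i m * T j k l m + C j m * T k i l m
                           + C k m * T i j l m) = 0) ->
    forall x y z w, mlin4 T y z w (x *m C) + mlin4 T z x w (y *m C)
      + mlin4 T x y w (z *m C) = 0.
  move=> compC x y z w; rewrite !mlin4_mulmx.
  (* All three terms get the argument order [x y z w]; the coefficients then add up to the index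
     form of compatibility. *)
  rewrite (mlin4_swap34 _ y z) (mlin4_swap23 _ y z) (mlin4_swap12 _ y x).
  rewrite (mlin4_swap12 _ z) (mlin4_swap34 _ x z) (mlin4_swap23 _ x z).
  rewrite (mlin4_swap34 _ x y w) 2!mlin4D; apply: mlin4_eq0 => i j k l.
  by rewrite -!big_split; exact: compC.
move=> i j k l.
(* The three omitted premises, the symmetries of [mlin4 T], become the last three bullets. *)
have := @jordan_cyclic_identity R 'rV[R]_n (mlin4 T) (mulmxr A) (mulmxr B)
  _ _ _ (compE _ compA) (compE _ compB)
  (delta_mx 0 i) (delta_mx 0 j) (delta_mx 0 k) (delta_mx 0 l).
(* [mulmxr A (mulmxr B x)] is [x *m (B *m A)]: the order is reversed, which the symmetric sum
   absorbs. *)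
rewrite /= -!mulmxA !mlin4_mulmx !mlin4_delta => jordan0.
rewrite -[RHS]jordan0.
- rewrite -!big_split; apply: eq_bigr => m _ /=.
  by rewrite ![(A *m B + B *m A) _ _]mxE; ring.
- move=> x y z w; rewrite mlin4_swap12 mlin4N; apply: eq_mlin4 => p q r s.
  by have [-> _ _ _] := symT q p r s.
- move=> x y z w; rewrite mlin4_swap23 mlin4_swap12 mlin4_swap34 mlin4_swap23.
  by apply: eq_mlin4 => p q r s; have [_ _ _ ->] := symT r s p q.
- move=> x y z w.
  rewrite (mlin4_swap12 _ z) (mlin4_swap23 _ x z) (mlin4_swap23 _ y).
  rewrite (mlin4_swap12 _ y) !mlin4D; apply: mlin4_eq0 => p q r s.
  by have [_ _ -> _] := symT p q r s.
Qed.

(** * Calculus of smooth functions on an open set *)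

Section SmoothFunctions.
Context {R : realType} {n : nat} (U : set 'rV[R]_n) (openU : open U).
Implicit Types f g : 'rV[R]_n -> R.

Lemma near_open_eq f g x : (forall y, U y -> f y = g y) -> U x ->
  {near x, f =1 g}.
Proof.
move=> fg Ux; have : nbhs x U by apply: open_nbhs_nbhs.
by apply: filterS => y /fg.
Qed.

Lemma eq_continuous_on f g x : (forall y, U y -> f y = g y) -> U x ->
  {for x, continuous f} -> {for x, continuous g}.
Proof.
move=> fg Ux cf; rewrite /prop_for /continuous_at -(fg x Ux).
exact: cvg_trans (near_eq_cvg (near_open_eq fg Ux)) cf.
Qed.

(** Since [U] is open, equality on [U] holds near each of its points, so derivatives agree there.
    This allows derivative formulas valid only on [U]. *)
Lemma eq_Ck_on k f g :
  (forall x, U x -> f x = g x) -> Ck_on k U f -> Ck_on k U g.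
Proof.
elim: k f g => [|k IH] f g fg [cf Df]; (split; [move=> x Ux|]) => //.
- by apply: eq_continuous_on (cf x Ux).
- by apply: eq_continuous_on (cf x Ux).
move=> i; have [df Ckf] := Df i; split.
  move=> x Ux; apply: near_eq_derivable (df x Ux); exact: near_open_eq.
apply: IH Ckf => x Ux; apply: near_eq_derive; exact: near_open_eq.
Qed.

(** Serves the product and inverse rules, where undifferentiated factors stand next to a derivative
    of lower order. *)
Lemma Ck_onW k f : Ck_on k.+1 U f -> Ck_on k U f.
Proof.
elim: k f => [|k IH] f; first by case.
by move=> [cf Df]; split=> // i; have [df /IH] := Df i.
Qed.

Lemma Ck_on_cst k (a : R) : Ck_on k U (fun=> a).
Proof.
have cf (c : R) x : U x -> {for x, continuous (fun=> c : R)}.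
  by move=> _; exact: cst_continuous.
elim: k a => [|k IH] a; first by split; first exact: cf.
split=> [|i]; first exact: cf.
split=> [x _|]; first exact: derivable_cst.
by apply: eq_Ck_on (IH 0) => x _; rewrite /pderive derive_cst.
Qed.

Lemma Ck_onD k f g :
  Ck_on k U f -> Ck_on k U g -> Ck_on k U (fun x => f x + g x).
Proof.
elim: k f g => [|k IH] f g [cf Df] [cg Dg].
  by split=> // x Ux; exact: continuousD (cf x Ux) (cg x Ux).
split=> [x Ux|i]; first exact: continuousD (cf x Ux) (cg x Ux).
have [[df Ckf] [dg Ckg]] := (Df i, Dg i).
split=> [x Ux|]; first exact: derivableD (df x Ux) (dg x Ux).
apply: eq_Ck_on (IH _ _ Ckf Ckg) => x Ux.
by rewrite /pderive -(deriveD (df x Ux) (dg x Ux)).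
Qed.

Lemma Ck_onM k f g :
  Ck_on k U f -> Ck_on k U g -> Ck_on k U (fun x => f x * g x).
Proof.
elim: k f g => [|k IH] f g Cf Cg; have [cf Df] := Cf; have [cg Dg] := Cg.
  by split=> // x Ux; exact: continuousM (cf x Ux) (cg x Ux).
split=> [x Ux|i]; first exact: continuousM (cf x Ux) (cg x Ux).
have [[df Ckf] [dg Ckg]] := (Df i, Dg i).
split=> [x Ux|]; first exact: derivableM (df x Ux) (dg x Ux).
apply: eq_Ck_on (Ck_onD (IH _ _ (Ck_onW Cf) Ckg)
                        (IH _ _ (Ck_onW Cg) Ckf)) => x Ux.
by rewrite /pderive [RHS](deriveM (df x Ux) (dg x Ux)).
Qed.

(** The derivative of [1/f] is [- (1/f) (1/f) f'], which involves the inverse of the same [f]; so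
    the induction on [k] keeps [f] fixed. *)
Lemma Ck_onV k f : (forall x, U x -> f x != 0) ->
  Ck_on k U f -> Ck_on k U (fun x => (f x)^-1).
Proof.
move=> f0; elim: k => [|k IH] Cf; have [cf Df] := Cf.
  by split=> // x Ux; exact: continuousV (f0 x Ux) (cf x Ux).
split=> [x Ux|i]; first exact: continuousV (f0 x Ux) (cf x Ux).
have [df Ckf] := Df i; have Cf' := IH (Ck_onW Cf).
split=> [x Ux|]; first exact: derivableV (f0 x Ux) (df x Ux).
apply: eq_Ck_on (Ck_onM (Ck_on_cst k (-1))
  (Ck_onM (Ck_onM Cf' Cf') Ckf)) => x Ux.
rewrite /pderive (deriveV (f0 x Ux) (df x Ux)).
by rewrite /GRing.scale /= mulN1r mulNr -invfM -expr2.
Qed.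

Lemma smooth_cst (a : R) : smooth_on U (fun=> a).
Proof. by move=> k; exact: Ck_on_cst. Qed.

Lemma smoothM f g :
  smooth_on U f -> smooth_on U g -> smooth_on U (fun x => f x * g x).
Proof. by move=> sf sg k; apply: Ck_onM. Qed.

Lemma smoothV f : (forall x, U x -> f x != 0) ->
  smooth_on U f -> smooth_on U (fun x => (f x)^-1).
Proof. by move=> f0 sf k; apply: Ck_onV. Qed.

Lemma eq_smooth f g :
  (forall x, U x -> f x = g x) -> smooth_on U f -> smooth_on U g.
Proof. by move=> fg sf k; apply: eq_Ck_on (sf k). Qed.

Lemma smooth_sum (I : Type) (r : seq I) (P : pred I)
    (F : I -> 'rV[R]_n -> R) :
  (forall i, P i -> smooth_on U (F i)) ->
  smooth_on U (fun x => \sum_(i <- r | P i) F i x).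
Proof.
move=> sF; elim: r => [|i r IH] k.
  by apply: eq_Ck_on (Ck_on_cst k 0) => x _; rewrite big_nil.
have [Pi|nPi] := boolP (P i); last first.
  by apply: eq_Ck_on (IH k) => x _; rewrite big_cons (negPf nPi).
by apply: eq_Ck_on (Ck_onD (sF i Pi k) (IH k)) => x _; rewrite big_cons Pi.
Qed.

Lemma smooth_prod (I : Type) (r : seq I) (P : pred I)
    (F : I -> 'rV[R]_n -> R) :
  (forall i, P i -> smooth_on U (F i)) ->
  smooth_on U (fun x => \prod_(i <- r | P i) F i x).
Proof.
move=> sF; elim: r => [|i r IH] k.
  by apply: eq_Ck_on (Ck_on_cst k 1) => x _; rewrite big_nil.
have [Pi|nPi] := boolP (P i); last first.
  by apply: eq_Ck_on (IH k) => x _; rewrite big_cons (negPf nPi).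
by apply: eq_Ck_on (Ck_onM (sF i Pi k) (IH k)) => x _; rewrite big_cons Pi.
Qed.

Definition smooth_mx p q (A : 'rV[R]_n -> 'M[R]_(p, q)) :=
  forall i j, smooth_on U (fun x => A x i j).

Lemma smooth_mxD p q (A B : 'rV[R]_n -> 'M[R]_(p, q)) :
  smooth_mx A -> smooth_mx B -> smooth_mx (fun x => A x + B x).
Proof.
move=> sA sB i j k; apply: eq_Ck_on (Ck_onD (sA i j k) (sB i j k)).
by move=> x _; rewrite mxE.
Qed.

Lemma smooth_mxZ p q (a : R) (A : 'rV[R]_n -> 'M[R]_(p, q)) :
  smooth_mx A -> smooth_mx (fun x => a *: A x).
Proof.
move=> sA i j; apply: eq_smooth (smoothM (smooth_cst a) (sA i j)).
by move=> x _; rewrite mxE.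
Qed.

Lemma smooth_mulmx p q r (A : 'rV[R]_n -> 'M[R]_(p, q))
    (B : 'rV[R]_n -> 'M[R]_(q, r)) :
  smooth_mx A -> smooth_mx B -> smooth_mx (fun x => A x *m B x).
Proof.
move=> sA sB i j.
apply: (eq_smooth (f := fun x => \sum_k A x i k * B x k j)) => [x _|].
  by rewrite mxE.
by apply: smooth_sum => k _; apply: smoothM.
Qed.

Lemma smooth_det p (A : 'rV[R]_n -> 'M[R]_p) :
  smooth_mx A -> smooth_on U (fun x => \det (A x)).
Proof.
(* The determinant unfolds to the Leibniz sum over permutations. *)
move=> sA; apply: smooth_sum => s _; apply: smoothM; first exact: smooth_cst.
by apply: smooth_prod.
Qed.

Lemma smooth_invmx p (A : 'rV[R]_n -> 'M[R]_p) :
  (forall x, U x -> A x \in unitmx) ->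
  smooth_mx A -> smooth_mx (fun x => invmx (A x)).
Proof.
move=> uA sA i j.
(* [invmx] is the adjugate over the determinant only at units, hence on [U]; the adjugate transposes
   the cofactor indices. *)
apply: (eq_smooth (f := fun x => (\det (A x))^-1 * cofactor (A x) j i)) => [x Ux|].
  by rewrite /invmx uA // !mxE.
apply: smoothM.
  apply: smoothV; last exact: smooth_det.
  by move=> x /uA; rewrite unitmxE unitfE.
apply: smoothM; first exact: smooth_cst.
apply: smooth_det => i' j'.
by apply: eq_smooth (sA (lift j i') (lift i j')) => x _; rewrite !mxE.
Qed.

End SmoothFunctions.

(** * Rank 2 tensors in matrix form *)

Lemma invmxM (R : comUnitRingType) (n : nat) (A B : 'M[R]_n) :
  A \in unitmx -> B \in unitmx -> invmx (A *m B) = invmx B *m invmx A.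
Proof.
move=> uA uB; have uAB : A *m B \in unitmx by rewrite unitmx_mul uA.
by rewrite -[RHS]mulmx1 -(mulmxV uAB) !mulmxA mulmxKV // mulVmx // mul1mx.
Qed.

Section Tensor2.
Context {R : realType} {n : nat} {M : manifold R n}.
Implicit Types (a b g : components2 M) (c d : chart R n M).

Definition tensor2_law b := forall c d p,
  atlas c -> atlas d -> chart_dom c p -> chart_dom d p ->
  b c p = jacobian_at c d p *m b d p *m (jacobian_at c d p)^T.

(** The transformation law becomes congruence by the Jacobian, open to matrix algebra. *)
Lemma tensor2P b : tensor2 b <->
  tensor2_law b /\
  forall c, atlas c -> smooth_mx (chart_cod c) (fun x => b c (chart_inv c x)).
Proof.
have lawE c d p : (forall i j, b c p i j =
      \sum_k \sum_l jacobian_at c d p i k * jacobian_at c d p j l * b d p k l)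
    <-> b c p = jacobian_at c d p *m b d p *m (jacobian_at c d p)^T.
  set J := jacobian_at c d p.
  have sumE i j : \sum_k \sum_l J i k * J j l * b d p k l
      = (J *m b d p *m J^T) i j.
    rewrite exchange_big mxE; apply: eq_bigr => l _; rewrite !mxE mulr_suml.
    by apply: eq_bigr => k _; rewrite mulrAC.
  split=> [bE|-> i j]; last by rewrite sumE.
  by apply/matrixP => i j; rewrite bE sumE.
split=> -[lawb sb]; split=> // c d p ac ad cp dp.
- by apply/lawE; apply: lawb.
- by move=> J; apply/lawE; apply: lawb.
Qed.

Lemma chart_invK (c : chart R n M) (x : 'rV[R]_n) :
  chart_cod c x -> chart_dom c (chart_inv c x).
Proof. by case=> p cp <-; rewrite chart_mapK. Qed.

Lemma raiseE g b c p : raise g b c p = b c p *m invmx (g c p).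
Proof. by apply/matrixP => i m; rewrite !mxE. Qed.

Lemma jordan_productE g a b c p :
  jordan_product g a b c p =
  2^-1 *: (a c p *m invmx (g c p) *m b c p + b c p *m invmx (g c p) *m a c p).
Proof.
by apply/matrixP => i j; rewrite -!raiseE !mxE big_split.
Qed.

Lemma metric_jacobian_unit g c d p : metric g ->
  atlas c -> atlas d -> chart_dom c p -> chart_dom d p ->
  jacobian_at c d p \in unitmx.
Proof.
move=> [[/tensor2P[lawg _] _] ug] ac ad cp dp.
have := ug c p ac cp; rewrite (lawg c d p) // !unitmx_mul.
by case/andP=> /andP[].
Qed.

Lemma tensor2_jordan_product g a b :
  metric g -> tensor2 a -> tensor2 b -> tensor2 (jordan_product g a b).
Proof.
move=> mg /tensor2P[lawa sa] /tensor2P[lawb sb]; apply/tensor2P.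
have [[/tensor2P[lawg sg] _] ug] := mg; split=> [c d p ac ad cp dp|c ac].
  have uJ := metric_jacobian_unit mg ac ad cp dp.
  rewrite !jordan_productE (lawa c d p) // (lawb c d p) // (lawg c d p) //.
  move: uJ; set J := jacobian_at c d p => uJ.
  have uJT : J^T \in unitmx by rewrite unitmx_tr.
  have -> : invmx (J *m g d p *m J^T)
      = invmx J^T *m invmx (g d p) *m invmx J.
    by rewrite !invmxM ?unitmx_mul ?uJ ?ug // mulmxA.
  (* The inner Jacobians cancel, so congruence passes through [a g^-1 b]. *)
  have conjJ (x y z : 'M[R]_n) : J *m x *m J^T
      *m (invmx J^T *m y *m invmx J) *m (J *m z *m J^T)
      = J *m (x *m y *m z) *m J^T.
    by rewrite !mulmxA mulmxK // mulmxKV.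
  by rewrite !conjJ -mulmxDl -mulmxDr -scalemxAr -scalemxAl.
have oc : open (chart_cod c) by exact: open_chart_cod.
have sgV := smooth_invmx oc (fun x cx => ug c _ ac (chart_invK cx)) (sg c ac).
rewrite (_ : (fun x => _) = fun x => 2^-1 *:
    (a c (chart_inv c x) *m invmx (g c (chart_inv c x)) *m b c (chart_inv c x)
   + b c (chart_inv c x) *m invmx (g c (chart_inv c x)) *m a c (chart_inv c x)));
  last by apply/funext => x; rewrite jordan_productE.
have sab := smooth_mulmx oc (smooth_mulmx oc (sa c ac) sgV) (sb c ac).
have sba := smooth_mulmx oc (smooth_mulmx oc (sb c ac) sgV) (sa c ac).
exact (smooth_mxZ oc _ (smooth_mxD oc sab sba)).
Qed.

(** Transposition reverses each triple product and so exchanges the two summands. *)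
Lemma jordan_product_tr g a b c p :
  (g c p)^T = g c p -> (a c p)^T = a c p -> (b c p)^T = b c p ->
  (jordan_product g a b c p)^T = jordan_product g a b c p.
Proof.
move=> gT aT bT; rewrite !jordan_productE linearZ linearD /= !trmx_mul.
by rewrite trmx_inv gT aT bT !mulmxA addrC.
Qed.

(** Raised tensors multiply as endomorphisms, which reduces compatibility to
    [compatible_jordan_mx]. *)
Lemma raise_jordan_product g a b c p :
  raise g (jordan_product g a b) c p =
  2^-1 *: (raise g a c p *m raise g b c p + raise g b c p *m raise g a c p).
Proof.
by rewrite !raiseE jordan_productE -scalemxAl mulmxDl !mulmxA.
Qed.

End Tensor2.

Theorem theorem4p2 (R : realType) (n : nat) (M : manifold R n)
    (g : components2 M) (K : components4 M) (a b : components2 M) :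
  metric g ->
  generalized_curvature_tensor K ->
  symmetric_tensor a -> K_compatible g K a ->
  symmetric_tensor b -> K_compatible g K b ->
  symmetric_tensor (jordan_product g a b) /\
  K_compatible g K (jordan_product g a b).
Proof.
move=> mg [_ symK] [ta syma] compa [tb symb] compb; split.
  split; first exact: tensor2_jordan_product.
  have [[_ symg] _] := mg.
  have trE (h : components2 M) c p :
      (forall i j, h c p i j = h c p j i) -> (h c p)^T = h c p.
    by move=> symh; apply/matrixP => i j; rewrite mxE symh.
  move=> c p ac cp i j.
  have /matrixP/(_ j i) := jordan_product_tr (trE _ _ _ (symg c p ac cp))
    (trE _ _ _ (syma c p ac cp)) (trE _ _ _ (symb c p ac cp)).
  by rewrite mxE.
move=> c p ac cp i j k l; rewrite raise_jordan_product.
have := compatible_jordan_mx (symK c p ac cp)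
  (compa c p ac cp) (compb c p ac cp) i j k l.
(* The matrix lemma concerns the full anticommutator [X]; the factor one half enters by
   linearity. *)
move=> /(congr1 ( *%R 2^-1)); set X := (_ *m _ + _).
rewrite mulr0 mulr_sumr => X0; rewrite -[RHS]X0; apply: eq_bigr => m _.
by rewrite ![(2^-1 *: X) _ _]mxE; ring.
Qed.
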